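(* Let $R$ be a (Krasner) hyperring. A hyperideal $\mathfrak p$ of $R$ is primitive if and only if the quotient hyperring $R/\mathfrak p$ is a primitive hyperring.
   Context: For a nonempty set $H$, $\mathcal P^*(H)$ is the set of nonempty subsets of $H$. A canonical hypergroup $(H,+,0)$ is a nonempty set $H$ with a hyperoperation $+\colon H\times H\to\mathcal P^*(H)$ and $0\in H$ (with $A+B=\bigcup_{a\in A,b\in B}(a+b)$ for subsets, and elements identified with singletons) such that for all $a,b,c\in H$: $a+b=b+a$; $a+(b+c)=(a+b)+c$; $a+0=\{a\}$; there is a unique $-a\in H$ with $0\in a-a:=a+(-a)$; and $a\in b+c$ implies $c\in -b+a$ and $b\in a-c$. A (Krasner) hyperring $R$ is a canonical hypergroup $(R,+,0)$ with an associative binary (single-valued) multiplication such that $a0=0a=0$, $a(b+c)=ab+ac$, $(a+b)c=ac+bc$; a multiplicative identity and commutativity are not assumed. A subhypergroup is a nonempty subset $S$ with $x-y\subseteq S$ for all $x,y\in S$. A hyperideal of $R$ is a subhypergroup $\mathfrak a$ with $ra\in\mathfrak a$ and $ar\in\mathfrak a$ for all $r\in R$, $a\in\mathfrak a$. The quotient hyperring is $R/\mathfrak a=\{\mathfrak a+r\mid r\in R\}$ with $(\mathfrak a+r_1)+(\mathfrak a+r_2)=\{\mathfrak a+r\mid r\in r_1+r_2\}$ and $(\mathfrak a+r_1)(\mathfrak a+r_2)=\mathfrak a+r_1r_2$. A (right) $R$-hypermodule is a canonical hypergroup $M$ with a map $M\times R\to M$, $(m,r)\mapsto mr$, such that $(m+m')r=mr+m'r$,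 $m(r+r')=mr+mr'$, $m(rr')=(mr)r'$, $m0=0$. A subhypermodule is a subhypergroup $S$ of $M$ with $sr\in S$ for all $s\in S$, $r\in R$. $M$ is simple if $MR\neq 0$ (i.e. $mr\ne0$ for some $m\in M,r\in R$) and its only subhypermodules are $0$ and $M$. $\mathtt{Ann}_R(M)=\{r\in R\mid mr=0\text{ for all }m\in M\}$. A proper hyperideal of $R$ is primitive if it equals $\mathtt{Ann}_R(M)$ for some simple $R$-hypermodule $M$. A hyperring is primitive if $\{0\}$ is a primitive hyperideal of it. *)

(* Defs.v *)
From HB Require Import structures.
From mathcomp Require Import all_boot.
From mathcomp Require Import boolp classical_sets.

Set Implicit Arguments.
Unset Strict Implicit.
Unset Printing Implicit Defensive.

Declare Scope hyper_scope.
Delimit Scope hyper_scope with hyp.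
Local Open Scope classical_set_scope.
Local Open Scope hyper_scope.

Definition setop {H : Type} (op : H -> H -> set H) (A B : set H) : set H :=
  \bigcup_(a in A) \bigcup_(b in B) op a b.

HB.mixin Record isCanonicalHypergroup (H : Type) := {
  hadd : H -> H -> set H;
  hzero : H;
  hopp : H -> H;
  hadd_neq0 : forall a b, hadd a b !=set0;
  haddC : forall a b, hadd a b = hadd b a;
  haddA : forall a b c,
    setop hadd [set a] (hadd b c) = setop hadd (hadd a b) [set c];
  hadd0 : forall a, hadd a hzero = [set a];
  hopp_unique : forall a, unique (fun b => hadd a b hzero) (hopp a);
  hadd_reversible : forall a b c, hadd b c a ->
    hadd (hopp b) a c /\ hadd a (hopp c) b
}.

#[short(type="canonicalHypergroupType")]
HB.structure Definition CanonicalHypergroup :=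
  { H of isCanonicalHypergroup H }.

(* A proposition [(a + b) x] would be read in [type_scope], where [+] is the
   sum of types: membership in a hypersum is written [hadd a b x]. *)
Notation "0" := (@hzero _) : hyper_scope.
Notation "x + y" := (hadd x y) : hyper_scope.
Notation "- x" := (hopp x) : hyper_scope.
Notation "x - y" := (hadd x (hopp y)) : hyper_scope.

HB.mixin Record CanonicalHypergroup_isHyperring (R : Type)
    of CanonicalHypergroup R := {
  hmul : R -> R -> R;
  hmulA : forall a b c, hmul a (hmul b c) = hmul (hmul a b) c;
  hmulr0 : forall a, hmul a (0 : R) = 0;
  hmul0r : forall a, hmul (0 : R) a = 0;
  hmulDr : forall a b c : R,
    [set hmul a x | x in b + c] = hmul a b + hmul a c;
  hmulDl : forall a b c : R,
    [set hmul x c | x in a + b] = hmul a c + hmul b c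
}.

#[short(type="hyperringType")]
HB.structure Definition Hyperring :=
  { R of CanonicalHypergroup R & CanonicalHypergroup_isHyperring R }.

Notation "x * y" := (hmul x y) : hyper_scope.

HB.mixin Record CanonicalHypergroup_isHypermodule (R : hyperringType)
    (M : Type) of CanonicalHypergroup M := {
  hact : M -> R -> M;
  hactDl : forall (m m' : M) (r : R),
    [set hact x r | x in m + m'] = hact m r + hact m' r;
  hactDr : forall (m : M) (r r' : R),
    [set hact m x | x in r + r'] = hact m r + hact m r';
  hactA : forall (m : M) (r r' : R), hact m (r * r') = hact (hact m r) r';
  hactr0 : forall m : M, hact m (0 : R) = 0
}.

#[short(type="hypermoduleType")]
HB.structure Definition Hypermodule (R : hyperringType) :=
  { M of CanonicalHypergroup M & CanonicalHypergroup_isHypermodule R M }.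

Definition subhypergroup {H : canonicalHypergroupType} (S : set H) : Prop :=
  S !=set0 /\ forall x y, S x -> S y -> x - y `<=` S.

Definition subhypermodule {R : hyperringType} {M : hypermoduleType R}
    (S : set M) : Prop :=
  subhypergroup S /\ forall (s : M) (r : R), S s -> S (hact s r).

Definition simple_hypermodule {R : hyperringType} (M : hypermoduleType R)
    : Prop :=
  (exists (m : M) (r : R), hact m r <> 0) /\
  (forall S : set M, subhypermodule S -> S = [set 0] \/ S = [set: M]).

Definition annihilator {R : hyperringType} (M : hypermoduleType R) : set R :=
  [set r | forall m : M, hact m r = 0].

Record hyperideal (R : hyperringType) := Hyperideal {
  hyperideal_set :> set R;
  hyperideal_sub : subhypergroup hyperideal_set;
  hyperideal_mul : forall r a : R, hyperideal_set a ->
    hyperideal_set (r * a) /\ hyperideal_set (a * r)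
}.

Section HypergroupTheory.
Variable H : canonicalHypergroupType.
Implicit Types (a b c x y : H) (S : set H).

Lemma haddAP a b c x :
  (exists2 y, (b + c) y & (a + y) x) <-> (exists2 y, (a + b) y & (y + c) x).
Proof.
have := haddA a b c => /(congr1 (@^~ x)) E; split.
- move=> [y bcy axy].
  have : setop hadd [set a] (b + c) x by exists a => //; exists y.
  by rewrite E => -[z abz [_ -> zcx]]; exists z.
- move=> [y aby ycx].
  have : setop hadd (a + b) [set c] x by exists y => //; exists c.
  by rewrite -E => -[_ -> [z bcz azx]]; exists z.
Qed.

Lemma haddrN a : (a - a) (0 : H).
Proof. by have [] := hopp_unique a. Qed.

Lemma hopp_eq a b : hadd a b 0 -> b = - a.
Proof. by have [_ h] := hopp_unique a => /h. Qed.

Lemma hopp0 : - (0 : H) = 0.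
Proof. by symmetry; apply: hopp_eq; rewrite hadd0. Qed.

Lemma hoppK a : - - a = a.
Proof. by symmetry; apply: hopp_eq; rewrite haddC; exact: haddrN. Qed.

Lemma hadd0l a : 0 + a = [set a].
Proof. by rewrite haddC hadd0. Qed.

Lemma hadd_oppP a b c : hadd a b c -> hadd (- a) (- b) (- c).
Proof.
move=> abc.
have [y bcy ay0] : exists2 y, (b - c) y & (a + y) (0 : H).
  by apply/haddAP; exists c => //; exact: haddrN.
move: bcy; rewrite (hopp_eq ay0) => /hadd_reversible [+ _].
by rewrite haddC.
Qed.

Lemma subhypergroup0 S : subhypergroup S -> S 0.
Proof. by move=> [[x Sx] h]; apply: (h x x Sx Sx); exact: haddrN. Qed.

Lemma subhypergroupN S x : subhypergroup S -> S x -> S (- x).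
Proof.
move=> sS Sx; have S0 := subhypergroup0 sS.
by have [_ h] := sS; apply: (h _ _ S0 Sx); rewrite hadd0l.
Qed.

Lemma subhypergroupD S x y : subhypergroup S -> S x -> S y -> x + y `<=` S.
Proof.
move=> sS Sx Sy; rewrite -[y]hoppK; have [_ h] := sS.
by apply: h => //; exact: subhypergroupN.
Qed.

End HypergroupTheory.

Section Quotient.
Variables (R : hyperringType) (p : hyperideal R).
Implicit Types (a b r s x y : R).

Let psub := hyperideal_sub p.

Definition coset r : set R := setop hadd p [set r].

Definition quotient : Type := {A : set R | exists r, A = coset r}.

Definition to_quotient r : quotient :=
  exist _ (coset r) (ex_intro _ r erefl).

Local Notation "[ r ]" := (to_quotient r) (format "[ r ]").

Definition quotient_repr (A : quotient) : R := sval (cid (svalP A)).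

(* Operations are defined on chosen representatives; [to_quotientD]
   and [to_quotientM] show that the choice is irrelevant. *)
Definition quotient_add (A B : quotient) : set quotient :=
  [set to_quotient r | r in quotient_repr A + quotient_repr B].
Definition quotient_opp (A : quotient) : quotient := [- quotient_repr A].
Definition quotient_mul (A B : quotient) : quotient :=
  [quotient_repr A * quotient_repr B].

Lemma quotient_reprK A : [quotient_repr A] = A.
Proof.
case: A => A hA; apply: eq_exist; rewrite /quotient_repr.
by case: cid.
Qed.

Lemma cosetP r x : coset r x <-> exists2 a, (p : set R) a & (a + r) x.
Proof.
split; first by move=> [a pa [_ -> ax]]; exists a.
by move=> [a pa ax]; exists a => //; exists r.
Qed.

Lemma coset_refl r : coset r r.
Proof. by apply/cosetP; exists 0; [exact: subhypergroup0|rewrite hadd0l]. Qed.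

Lemma coset_sym r s : coset r s -> coset s r.
Proof.
move=> /cosetP[a pa /hadd_reversible[h _]].
by apply/cosetP; exists (- a) => //; exact: subhypergroupN.
Qed.

Lemma coset_trans r s x : coset r s -> coset s x -> coset r x.
Proof.
move=> /cosetP[a pa ars] /cosetP[b pb bsx].
have [y bay yrx] : exists2 y, (b + a) y & (y + r) x.
  by apply/haddAP; exists s.
by apply/cosetP; exists y => //; exact: (subhypergroupD psub pb pa bay).
Qed.

Lemma to_quotientP r s : [r] = [s] <-> coset r s.
Proof.
split=> [[->]|rs]; first exact: coset_refl.
apply: eq_exist; apply/seteqP; split=> x.
- by apply: coset_trans; exact: coset_sym.
- exact: coset_trans.
Qed.

Lemma coset_add r r' s s' x : coset r r' -> coset s s' -> hadd r s x ->
  exists2 x', (r' + s') x' & coset x x'.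
Proof.
have step u u' v z : coset u u' -> hadd u v z ->
    exists2 z', (u' + v) z' & coset z z'.
  move=> /coset_sym /cosetP[a pa au'u] uvz.
  have [z' u'vz' az'z] : exists2 y, (u' + v) y & (a + y) z.
    by apply/haddAP; exists u.
  by exists z' => //; apply: coset_sym; apply/cosetP; exists a.
move=> rr' ss' /(step _ _ _ _ rr')[y]; rewrite haddC => /(step _ _ _ _ ss').
move=> [z]; rewrite haddC => r's'z yz xy.
by exists z => //; exact: coset_trans yz.
Qed.

Lemma coset_repr r : coset r (quotient_repr [r]).
Proof. by apply/to_quotientP; rewrite quotient_reprK. Qed.

Lemma quotient_addE r s :
  quotient_add [r] [s] = [set to_quotient x | x in r + s].
Proof.
apply/seteqP; split=> _ [x xrs <-].
- have [||x' h xx'] := coset_add (r' := r) (s' := s) _ _ xrs.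
  + exact/coset_sym/coset_repr.
  + exact/coset_sym/coset_repr.
  by exists x' => //; apply/to_quotientP; exact: coset_sym.
- have [x' h xx'] := coset_add (coset_repr r) (coset_repr s) xrs.
  by exists x' => //; apply/to_quotientP; exact: coset_sym.
Qed.

Lemma quotient_oppE r : quotient_opp [r] = [- r].
Proof.
apply/to_quotientP/coset_sym.
have /cosetP[a pa /hadd_oppP h] := coset_repr r.
by apply/cosetP; exists (- a) => //; exact: subhypergroupN.
Qed.

Lemma quotient_mulE r s : quotient_mul [r] [s] = [r * s].
Proof.
set r' := quotient_repr [r]; set s' := quotient_repr [s].
apply/to_quotientP/coset_sym.
have /cosetP[a pa ar] := coset_repr r.
have /cosetP[b pb bs] := coset_repr s.
apply: (@coset_trans _ (r * s')).
- apply/cosetP; exists (r * b); first by have [] := hyperideal_mul r pb.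
  by rewrite -hmulDr; exists s'.
- apply/cosetP; exists (a * s'); first by have [] := hyperideal_mul s' pa.
  by rewrite -hmulDl; exists r'.
Qed.

Lemma quotient_ind (P : quotient -> Prop) : (forall r, P [r]) -> forall A, P A.
Proof. by move=> h A; rewrite -(quotient_reprK A). Qed.

Lemma quotient_add_neq0 A B : quotient_add A B !=set0.
Proof.
have [x hx] := hadd_neq0 (quotient_repr A) (quotient_repr B).
by exists [x]; exists x.
Qed.

Lemma quotient_addC A B : quotient_add A B = quotient_add B A.
Proof. by rewrite /quotient_add haddC. Qed.

Lemma quotient_addA A B C :
  setop quotient_add [set A] (quotient_add B C) =
  setop quotient_add (quotient_add A B) [set C].
Proof.
elim/quotient_ind: A => a; elim/quotient_ind: B => b; elim/quotient_ind: C => c.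
rewrite !quotient_addE; apply/seteqP; split=> X.
- move=> [_ -> [_ [y bcy <-]]]; rewrite quotient_addE => -[x ayx <-].
  have /haddAP[z abz zcx] : exists2 y, (b + c) y & (a + y) x by exists y.
  exists [z]; first by exists z.
  by exists [c] => //; rewrite quotient_addE; exists x.
- move=> [_ [y aby <-]] [_ ->]; rewrite quotient_addE => -[x ycx <-].
  have /haddAP[z bcz azx] : exists2 y, (a + b) y & (y + c) x by exists y.
  exists [a] => //; exists [z]; first by exists z.
  by rewrite quotient_addE; exists x.
Qed.

Lemma quotient_add0 A : quotient_add A [0] = [set A].
Proof.
elim/quotient_ind: A => a; rewrite quotient_addE hadd0.
exact: image_set1.
Qed.

Lemma quotient_opp_unique A :
  unique (fun B => quotient_add A B [0]) (quotient_opp A).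
Proof.
elim/quotient_ind: A => a; rewrite quotient_oppE; split.
  by rewrite quotient_addE; exists 0 => //; exact: haddrN.
elim/quotient_ind => b; rewrite quotient_addE => -[x abx /to_quotientP].
move=> /cosetP[c pc /hadd_reversible[_]]; rewrite hadd0l => xc.
have px : (p : set R) x.
  by rewrite -[x]hoppK -xc; exact: subhypergroupN.
apply/to_quotientP/cosetP; exists x => //.
by rewrite haddC; have [] := hadd_reversible _ _ _ abx.
Qed.

Lemma quotient_add_reversible A B C : quotient_add B C A ->
  quotient_add (quotient_opp B) A C /\ quotient_add A (quotient_opp C) B.
Proof.
elim/quotient_ind: B => b; elim/quotient_ind: C => c.
rewrite !quotient_oppE quotient_addE => -[a /hadd_reversible[h1 h2] <-].
by rewrite !quotient_addE; split; [exists c|exists b].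
Qed.

HB.instance Definition _ := isCanonicalHypergroup.Build quotient
  quotient_add_neq0 quotient_addC quotient_addA quotient_add0
  quotient_opp_unique quotient_add_reversible.

Lemma to_quotientD r s : [r] + [s] = [set to_quotient x | x in r + s].
Proof. exact: quotient_addE. Qed.

Lemma quotient_mulA A B C :
  quotient_mul A (quotient_mul B C) = quotient_mul (quotient_mul A B) C.
Proof.
elim/quotient_ind: A => a; elim/quotient_ind: B => b; elim/quotient_ind: C => c.
by rewrite !quotient_mulE hmulA.
Qed.

Lemma quotient_mulr0 A : quotient_mul A (0 : quotient) = 0.
Proof. by elim/quotient_ind: A => a; rewrite quotient_mulE hmulr0. Qed.

Lemma quotient_mul0r A : quotient_mul (0 : quotient) A = 0.
Proof. by elim/quotient_ind: A => a; rewrite quotient_mulE hmul0r. Qed.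

Lemma quotient_mulDr (A B C : quotient) :
  [set quotient_mul A X | X in B + C] = quotient_mul A B + quotient_mul A C.
Proof.
elim/quotient_ind: A => a; elim/quotient_ind: B => b; elim/quotient_ind: C => c.
rewrite !quotient_mulE !to_quotientD -hmulDr.
rewrite !image_comp; apply: eq_imagel => x _ /=; exact: quotient_mulE.
Qed.

Lemma quotient_mulDl (A B C : quotient) :
  [set quotient_mul X C | X in A + B] = quotient_mul A C + quotient_mul B C.
Proof.
elim/quotient_ind: A => a; elim/quotient_ind: B => b; elim/quotient_ind: C => c.
rewrite !quotient_mulE !to_quotientD -hmulDl.
rewrite !image_comp; apply: eq_imagel => x _ /=; exact: quotient_mulE.
Qed.

HB.instance Definition _ := CanonicalHypergroup_isHyperring.Build quotient
  quotient_mulA quotient_mulr0 quotient_mul0r quotient_mulDr quotient_mulDl.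

Lemma to_quotientM r s : [r] * [s] = [r * s].
Proof. exact: quotient_mulE. Qed.

End Quotient.

Section ZeroHyperideal.
Variable R : hyperringType.

Lemma zero_subhypergroup : subhypergroup [set 0 : R].
Proof.
by split; [exists 0|move=> _ _ -> -> x; rewrite hopp0 hadd0].
Qed.

Lemma zero_mul (r a : R) : [set 0 : R] a ->
  [set 0 : R] (r * a) /\ [set 0 : R] (a * r).
Proof. by move=> ->; rewrite hmulr0 hmul0r. Qed.

Definition zero_hyperideal : hyperideal R :=
  Hyperideal zero_subhypergroup zero_mul.

End ZeroHyperideal.

Definition primitive_hyperideal {R : hyperringType} (p : hyperideal R) : Prop :=
  p <> [set: R] :> set R /\
  exists M : hypermoduleType R,
    simple_hypermodule M /\ p = annihilator M :> set R.

Definition primitive_hyperring (R : hyperringType) : Prop :=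
  primitive_hyperideal (zero_hyperideal R).

(* Main.v *)
From HB Require Import structures.
From mathcomp Require Import all_boot.
From mathcomp Require Import boolp classical_sets.
Require Import Defs.

(** A hypermodule over [R / p] is the same thing as a hypermodule over [R]
    annihilated by [p], on the same hypergroup. The correspondence preserves
    subhypermodules, hence simplicity, and [r] kills the module exactly when its
    coset does; so the annihilator over [R] is [p] iff the one over [R / p] is
    zero. *)

Set Implicit Arguments.
Unset Strict Implicit.
Unset Printing Implicit Defensive.

Local Open Scope classical_set_scope.
Local Open Scope hyper_scope.

(** The zero of [quotient p] is the class of [0], and [coset p 0] is [p] itself since [a + 0 =
    [set a]]. *)
Lemma to_quotient_eq0 (R : hyperringType) (p : hyperideal R) (r : R) :
  to_quotient p r = 0 <-> (p : set R) r.
Proof.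
split=> [/esym/to_quotientP/cosetP[a pa]|pr]; first by rewrite hadd0 => ->.
by apply/esym/to_quotientP/cosetP; exists r; rewrite ?hadd0.
Qed.

(** As [to_quotient p] is onto, a set of classes is determined by its preimage. This transfers both
    properness ([A] the whole quotient) and the annihilator condition. *)
Lemma zero_hyperideal_quotientP (R : hyperringType) (p : hyperideal R)
    (A : set (quotient p)) :
  zero_hyperideal (quotient p) = A :> set (quotient p) <->
  p = to_quotient p @^-1` A :> set R.
Proof.
split=> [<-|pE]; apply/seteqP; split.
- by move=> r /to_quotient_eq0.
- by move=> r /to_quotient_eq0.
- elim/quotient_ind => r /= /to_quotient_eq0.
  by rewrite [in X in X -> _]pE.
- elim/quotient_ind => r Ar; apply/to_quotient_eq0.
  by rewrite pE.
Qed.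

Section RestrictionOfScalars.
Variables (R : hyperringType) (p : hyperideal R).
Variable M : hypermoduleType (quotient p).

Definition restriction : Type := M.

HB.instance Definition _ := CanonicalHypergroup.on restriction.

Definition restriction_act (m : restriction) (r : R) : restriction :=
  hact (m : M) (to_quotient p r).

Lemma restriction_actDl (m m' : restriction) (r : R) :
  [set restriction_act x r | x in m + m'] =
  restriction_act m r + restriction_act m' r.
Proof. exact: (hactDl (m : M)). Qed.

Lemma restriction_actDr (m : restriction) (r r' : R) :
  [set restriction_act m x | x in r + r'] =
  restriction_act m r + restriction_act m r'.
Proof.
rewrite /restriction_act.
have := hactDr (m : M) (to_quotient p r) (to_quotient p r').
by rewrite to_quotientD image_comp.
Qed.

Lemma restriction_actA (m : restriction) (r r' : R) :
  restriction_act m (r * r') = restriction_act (restriction_act m r) r'.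
Proof. by rewrite /restriction_act -to_quotientM hactA. Qed.

Lemma restriction_actr0 (m : restriction) : restriction_act m 0 = 0.
Proof. exact: (hactr0 (m : M)). Qed.

HB.instance Definition _ := CanonicalHypergroup_isHypermodule.Build R restriction
  restriction_actDl restriction_actDr restriction_actA restriction_actr0.

Lemma annihilator_restriction :
  annihilator restriction = to_quotient p @^-1` annihilator M.
Proof. by []. Qed.

(** Every scalar of the quotient is the class of some [r], so a set stable under [R] is stable under
    [quotient p]. *)
Lemma simple_restriction :
  simple_hypermodule M -> simple_hypermodule restriction.
Proof.
move=> [[m [A mA]] simM]; split.
  by elim/quotient_ind: A mA => r mr; exists m, r.
move=> S [subS actS]; apply: (simM S); split=> // s B.
by elim/quotient_ind: B => r /(actS s r).
Qed.

End RestrictionOfScalars.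

Section Descent.
Variables (R : hyperringType) (p : hyperideal R) (M : hypermoduleType R).
Hypothesis pM : p `<=` annihilator M.

(* The proof is a phantom argument: the action of the quotient on this type
   satisfies the axioms only in its presence. *)
Definition descent of p `<=` annihilator M : Type := M.

Local Notation N := (descent pM).

HB.instance Definition _ := CanonicalHypergroup.copy N M.

(** An element [a] of [p] kills [m], so acting on [m] by [a + r] gives [0 + hact m r], a singleton.
    Hence the action by a representative depends only on its class. *)
Lemma hact_coset (m : M) (r s : R) : coset p r s -> hact m s = hact m r.
Proof.
move=> /cosetP[a pa ars].
have : [set hact m x | x in a + r] (hact m s) by exists s.
by rewrite hactDr pM// hadd0l.
Qed.

Definition descent_act (m : N) (A : quotient p) : N :=
  hact (m : M) (quotient_repr A).

Lemma descent_actE (m : N) (r : R) :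
  descent_act m (to_quotient p r) = hact (m : M) r.
Proof. exact: hact_coset (coset_repr p r). Qed.

Lemma descent_actDl (m m' : N) (A : quotient p) :
  [set descent_act x A | x in m + m'] = descent_act m A + descent_act m' A.
(* The same representative of [A] acts in all three terms. *)
Proof. exact: (hactDl (m : M)). Qed.

Lemma descent_actDr (m : N) (A B : quotient p) :
  [set descent_act m X | X in A + B] = descent_act m A + descent_act m B.
Proof.
elim/quotient_ind: A => r; elim/quotient_ind: B => s.
rewrite !descent_actE to_quotientD image_comp.
rewrite (_ : _ @` _ = [set hact (m : M) x | x in r + s]).
  exact: (hactDr (m : M)).
by apply: eq_imagel => x _ /=; exact: descent_actE.
Qed.

Lemma descent_actA (m : N) (A B : quotient p) :
  descent_act m (A * B) = descent_act (descent_act m A) B.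
Proof.
elim/quotient_ind: A => r; elim/quotient_ind: B => s.
by rewrite to_quotientM !descent_actE hactA.
Qed.

Lemma descent_actr0 (m : N) : descent_act m 0 = 0.
Proof. by rewrite descent_actE; exact: (hactr0 (m : M)). Qed.

HB.instance Definition _ :=
  CanonicalHypergroup_isHypermodule.Build (quotient p) N
    descent_actDl descent_actDr descent_actA descent_actr0.

Lemma annihilator_descent :
  to_quotient p @^-1` annihilator N = annihilator M.
Proof.
apply/seteqP; split=> r rM m.
(* The action on [N] is [descent_act] by definition; displaying it so lets [descent_actE] apply. *)
- by have := rM m; rewrite -[LHS]/(descent_act m _) descent_actE.
- by rewrite -[LHS]/(descent_act m _) descent_actE; exact: rM.
Qed.

Lemma simple_descent : simple_hypermodule M -> simple_hypermodule N.
Proof.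
move=> [[m [r mr]] simM]; split.
  exists m, (to_quotient p r).
  by rewrite -[hact _ _]/(descent_act m _) descent_actE.
move=> S [subS actS]; apply: (simM S); split=> // s x Ss.
have := actS s (to_quotient p x) Ss.
by rewrite -[hact _ _]/(descent_act s _) descent_actE.
Qed.

End Descent.

Theorem proposition3p8 (R : hyperringType) (p : hyperideal R) :
  primitive_hyperideal p <-> primitive_hyperring (quotient p).
Proof.
(* The whole quotient pulls back to the whole of [R], so [p] and the zero hyperideal of [quotient p]
   are proper together. *)
have properE : zero_hyperideal (quotient p) = setT :> set (quotient p) <->
    p = setT :> set R.
  by rewrite zero_hyperideal_quotientP preimage_setT.
split=> -[pT [M [simM annM]]]; (split; first by move/properE).
- have pM : p `<=` annihilator M by rewrite -annM.
  exists (descent pM); split; first exact: simple_descent.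
  by apply/zero_hyperideal_quotientP; rewrite annihilator_descent.
- exists (restriction M); split; first exact: simple_restriction.
  by rewrite annihilator_restriction; apply/zero_hyperideal_quotientP.
Qed.
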